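(* Let $X$ be a graph such that $X \cong \mathscr{P}(G)$ for some finite group $G$. Let $U(X)$ be the set of vertices of $X$ which are joined to all other vertices, and for each vertex $a$ of $X$ let $N_a$ be computed in $X$. Define a simple graph $Y$ on the vertex set of $X$ as follows. (i) If $X$ is complete, then $Y$ is the complete graph. (ii) If $X$ is not complete and $|U(X)| > 2$, then $Y$ is the complete graph. (iii) If $X$ is not complete and $|U(X)| \leq 2$, then for distinct vertices $a,b$ of $X$: - if $a \sim b$ in $X$, then $a \sim b$ in $Y$; - if $a \nsim b$ in $X$ and $N_a = N_b = k$, then $a \sim b$ in $Y$ if and only if there exists a vertex $c$ of $X$ with $a \sim c$ and $b \sim c$ in $X$ and $N_c > k$; - if $a \nsim b$ in $X$ and $N_a \neq N_b$, then $a \sim b$ in $Y$ if and only if there exists a vertex $c$ of $X$ with $a \sim c$ and $b \sim c$ in $X$ and $N_c \geq \max\{N_a, N_b\}$. Then $Y \cong \mathscr{P}_e(G)$.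
   Context: For a group $G$, the power graph $\mathscr{P}(G)$ is the simple graph with vertex set $G$ in which two distinct vertices $a,b$ are adjacent if and only if $\langle a\rangle \subseteq \langle b\rangle$ or $\langle b\rangle \subseteq \langle a\rangle$. The enhanced power graph $\mathscr{P}_e(G)$ is the simple graph with vertex set $G$ in which two distinct vertices $a,b$ are adjacent if and only if there exists $c \in G$ with $a,b \in \langle c\rangle$. The notation $a\sim b$ means that $a$ and $b$ are adjacent in the indicated graph, and $a\nsim b$ that they are not. For a vertex $a$ of a simple graph $X$, $N(a)$ denotes the set of neighbors of $a$ in $X$ (so $a\notin N(a)$), $\widetilde{N(a)} = \{b \in N(a) \mid N(a)\setminus\{b\} = N(b)\setminus\{a\}\}$ is the set of closed twins of $a$, and $N_a = |\widetilde{N(a)}| + 1$. *)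

(* Defs.v *)
From mathcomp Require Import all_boot all_fingroup.

Set Implicit Arguments.
Unset Strict Implicit.
Unset Printing Implicit Defensive.

Local Open Scope group_scope.

Record sgraph := SGraph {
  vertex :> finType;
  adj : rel vertex;
  adj_sym : symmetric adj;
  adj_irrefl : irreflexive adj
}.

Arguments adj {s} a b : rename.

Notation "a -- b" := (adj a b) (at level 30) : bool_scope.

Definition graph_iso (X Y : sgraph) : Prop :=
  exists2 f : X -> Y, bijective f & forall a b : X, (f a -- f b) = (a -- b).

Section GroupGraphs.
Variable gT : finGroupType.
Implicit Types a b : gT.

Definition power_adj : rel gT := fun a b =>
  (a != b) && ((<[a]> \subset <[b]>) || (<[b]> \subset <[a]>)).

Fact power_adj_sym : symmetric power_adj.
Proof. by move=> a b; rewrite /power_adj eq_sym orbC. Qed.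

Fact power_adj_irrefl : irreflexive power_adj.
Proof. by move=> a; rewrite /power_adj eqxx. Qed.

Definition power_graph : sgraph := SGraph power_adj_sym power_adj_irrefl.

Definition epower_adj : rel gT := fun a b =>
  (a != b) && [exists c : gT, (a \in <[c]>) && (b \in <[c]>)].

Fact epower_adj_sym : symmetric epower_adj.
Proof.
move=> a b; rewrite /epower_adj eq_sym; congr andb.
by apply: eq_existsb => c; rewrite andbC.
Qed.

Fact epower_adj_irrefl : irreflexive epower_adj.
Proof. by move=> a; rewrite /epower_adj eqxx. Qed.

Definition enhanced_power_graph : sgraph :=
  SGraph epower_adj_sym epower_adj_irrefl.

End GroupGraphs.

Section GraphNotions.
Variable X : sgraph.
Implicit Types a b c : X.

Definition complete : bool := [forall a : X, forall b : X, (a != b) ==> a -- b].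

Definition universal_vertices : {set X} :=
  [set a : X | [forall b : X, (b != a) ==> a -- b]].

Definition neighbors a : {set X} := [set b : X | a -- b].

Definition closed_twins a : {set X} :=
  [set b in neighbors a | neighbors a :\ b == neighbors b :\ a].

Definition twin_number a : nat := #|closed_twins a|.+1.

(* In the paper's notation, universal_vertices is U(X), neighbors a is N(a) and
   twin_number a is N_a; the graph Y is reconstruction X. It only depends on
   the graph X, not on a group whose power graph is isomorphic to X. *)
Definition recon_adj : rel X := fun a b =>
  (a != b) &&
  (if complete then true
   else if 2 < #|universal_vertices| then true
   else if a -- b then true
   else if twin_number a == twin_number b then
     [exists c : X, [&& a -- c, b -- c & twin_number a < twin_number c]]
   else
     [exists c : X, [&& a -- c, b -- c &
        maxn (twin_number a) (twin_number b) <= twin_number c]]).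

Fact recon_adj_sym : symmetric recon_adj.
Proof.
move=> a b; rewrite /recon_adj eq_sym (adj_sym a b) maxnC; congr andb.
case: complete => //; case: ifP => // _; case: ifP => // _.
rewrite [in RHS]eq_sym; case: eqP => [->|_];
  by apply: eq_existsb => c; rewrite andbCA.
Qed.

Fact recon_adj_irrefl : irreflexive recon_adj.
Proof. by move=> a; rewrite /recon_adj eqxx. Qed.

Definition reconstruction : sgraph := SGraph recon_adj_sym recon_adj_irrefl.

End GraphNotions.

(* Main.v *)
(* Take X to be the power graph P(G) itself. If P(G) is not complete but has more
   than two universal vertices, then G is cyclic: a universal u of maximal order
   has order > 2, and either u generates G, or G is a p-group whose subgroup of
   order p is unique, hence cyclic or generalized quaternion; the latter is
   impossible because u is central.
   In the remaining case let a, b be non-adjacent.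
   - If a, b lie in a common <c>, then c does not have prime power order, and this
     forces the twins of a to be exactly the generators of <a>, so that N_a =
     phi(o(a)), and likewise for b. Now phi(o(a)) <= phi(o(c)) <= N_c, with
     equality on the left only if o(c) = 2 o(a), which cannot happen for both a
     and b since they would then generate the same subgroup of <c>.
   - A common neighbour c such that a, b do not both lie in <c> lies in both <a>
     and <b>. If c is not universal, N_c <= min(N_a, N_b): this is clear if the
     twins of c are the generators of <c>; otherwise c and its twins are p-elements,
     a is a p-element too, and <a> properly contains every twin of c, so that
     N_c < p^t <= phi(o(a)), where p^t is the maximal order of a twin of c. If c is
     universal, N_c <= 2; if there are two universal vertices, the one other than 1
     has order 2, so N_a, N_b >= 2 because an element of order 2 comparable with it
     is equal to it. Each case contradicts the condition on N_c. *)
Require Import Defs.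
From mathcomp Require Import all_boot all_fingroup all_solvable.

Set Implicit Arguments.
Unset Strict Implicit.
Unset Printing Implicit Defensive.

Local Open Scope group_scope.

(** * Euler's totient along divisibility *)

Lemma leq_totient_dvd m n : 0 < n -> m %| n -> totient m <= totient n.
Proof.
(* Multiplying by one prime suffices: write [k = j * p ^ e] with [j] prime to [p] and compare only
   the factors at [p]. *)
have step p k : prime p -> totient k <= totient (p * k).
  move=> p_pr; case: (posnP k) => [->|k0]; first by rewrite muln0.
  have [j co_j ->] := pfactor_coprime p_pr k0; set e := logn p k.
  have co_e f : coprime j (p ^ f) by rewrite coprime_sym coprimeXl.
  rewrite mulnCA -expnS !totient_coprime // leq_mul2l; apply/orP; right.
  rewrite [in leqRHS]totient_pfactor //=.
  case: e => [|e]; first by rewrite muln1 -(totient_prime p_pr) totient_gt0 prime_gt0.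
  by rewrite totient_pfactor //= leq_mul2l leq_exp2l ?prime_gt1 ?leqnSn ?orbT.
move=> n0 /dvdnP[k def_n]; rewrite {n}def_n in n0 *.
elim/ltn_ind: k n0 => k IH; rewrite muln_gt0 => /andP[k0 m0].
have [k1|k1] := leqP k 1.
  by have -> : k = 1%N; [apply/eqP; rewrite eqn_leq k1 | rewrite mul1n].
have p_pr := pdiv_prime k1.
have q0 : 0 < k %/ pdiv k by rewrite divn_gt0 ?pdiv_gt0 // pdiv_leq.
rewrite -(divnK (pdiv_dvd k)) [(_ * pdiv k)%N]mulnC -mulnA.
apply: leq_trans (step _ _ p_pr); apply: IH; last by rewrite muln_gt0 q0.
by rewrite ltn_Pdiv ?prime_gt1.
Qed.

(** By monotonicity, all numbers between [m] and [n] in the divisibility order share one totient.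
    Multiplying by a prime [p] preserves the totient only if [p = 2] and the number was odd, so this
    can happen only once. *)
Lemma totient_dvd_eq m n : 0 < n -> m %| n -> m != n ->
  totient m = totient n -> n = m.*2.
Proof.
have step p k : prime p -> 0 < k -> totient (p * k) = totient k ->
    (p = 2) /\ coprime p k.
  move=> p_pr k0; have [j co_j def_k] := pfactor_coprime p_pr k0.
  set e := logn p k in def_k.
  have co_e f : coprime j (p ^ f) by rewrite coprime_sym coprimeXl.
  have j0 : 0 < j by move: k0; rewrite def_k muln_gt0 => /andP[].
  rewrite {1 2}def_k mulnCA -expnS !totient_coprime // => /eqP.
  rewrite eqn_pmul2l ?totient_gt0 // totient_pfactor //.
  have p1 := prime_gt1 p_pr.
  case: e def_k => [|e] def_k.
    rewrite muln1 => /eqP e2; split; last by rewrite def_k muln1.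
    by case: (p) p1 e2 => [|[|[|]]].
  rewrite totient_pfactor //= eqn_pmul2l ?eqn_exp2l //.
    by rewrite eqn_leq ltnn.
  by case: (p) p1 => [|[]].
move=> n0 /dvdnP[k def_n]; rewrite {n}def_n in n0 *.
have [k0 m0] : 0 < k /\ 0 < m by move: n0; rewrite muln_gt0 => /andP[].
move=> ne tot_eq.
have sandwich d l : k = (d * l)%N -> totient (l * m) = totient m.
  move=> def_k; have l0 : 0 < l by move: k0; rewrite def_k muln_gt0 => /andP[].
  apply/eqP; rewrite eqn_leq {1}tot_eq; apply/andP.
  split; apply: leq_totient_dvd; rewrite ?muln_gt0 ?k0 ?l0 ?m0 //; last exact: dvdn_mull.
  by rewrite def_k -mulnA dvdn_mull.
have k1 : 1 < k by case: k k0 ne {tot_eq n0 sandwich} => [|[|k]] //; rewrite mul1n eqxx.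
have p_pr := pdiv_prime k1; set p := pdiv k in p_pr.
have def_k := divnK (pdiv_dvd k); rewrite -/p in def_k.
have [p2 co_m] := step p m p_pr m0 (sandwich _ _ (esym def_k)).
have [d1|d1] := leqP (k %/ p) 1.
  have kp : k %/ p = 1%N.
    by apply/eqP; rewrite eqn_leq d1 divn_gt0 ?pdiv_gt0 // pdiv_leq.
  by rewrite -def_k kp mul1n p2 mul2n.
have q_pr := pdiv_prime d1; set q := pdiv (k %/ p) in q_pr.
have def_d := divnK (pdiv_dvd (k %/ p)); rewrite -/q in def_d.
have pm0 : 0 < p * m by rewrite muln_gt0 m0 prime_gt0.
have [] := step q (p * m)%N q_pr pm0.
  rewrite mulnA (sandwich ((k %/ p) %/ q) (q * p)%N) ?mulnA ?def_d //.
  by rewrite (sandwich _ _ (esym def_k)).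
by move=> ->; rewrite p2 coprimeMr.
Qed.

(** * Closed neighbourhoods and twin classes *)

Section ClosedTwins.
Variable X : sgraph.
Implicit Types a b x : X.

Definition closed_adj : rel X := fun a b => (a == b) || (a -- b).

(** Unlike in [closed_twins], each vertex is its own twin, so that the classes have size exactly
    [twin_number]. *)
Definition twin : rel X :=
  fun a b => [forall x, closed_adj a x == closed_adj b x].

Lemma twinP a b : reflect (closed_adj a =1 closed_adj b) (twin a b).
Proof. by apply: (iffP forallP) => h x; apply/eqP. Qed.

Lemma twin_refl a : twin a a. Proof. exact/twinP. Qed.

Lemma twin_sym : symmetric twin.
Proof. by move=> a b; apply/twinP/twinP => h x. Qed.

Lemma closed_adj_sym : symmetric closed_adj.
Proof. by move=> a b; rewrite /closed_adj eq_sym adj_sym. Qed.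

Lemma closed_adjxx a : closed_adj a a.
Proof. by rewrite /closed_adj eqxx. Qed.

Lemma universalP a :
  reflect (forall x, closed_adj a x) (a \in universal_vertices X).
Proof.
rewrite inE; apply: (iffP forallP) => h x; have := h x; rewrite /closed_adj.
  by rewrite eq_sym; case: eqP.
by rewrite eq_sym; case: eqP.
Qed.

Lemma twin_universal a b : twin a b ->
  (a \in universal_vertices X) = (b \in universal_vertices X).
Proof. by move/twinP=> ab; apply/universalP/universalP => h x; rewrite ?ab // -ab. Qed.

Lemma universal_twin a b : a \in universal_vertices X ->
  twin a b = (b \in universal_vertices X).
Proof.
move=> Ua; apply/idP/idP => [/twin_universal <- // | /universalP Ub].
by apply/twinP => x; rewrite Ub; apply/universalP.
Qed.

Lemma twin_numberE a : twin_number a = #|[set b | twin a b]|.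
Proof.
have -> : [set b | twin a b] = a |: closed_twins a.
  apply/setP => b; rewrite !inE; have [->|ne] := eqVneq b a.
    exact: twin_refl.
  apply/twinP/andP => [ab | [ab /eqP/setP eN] x].
    have adjab : a -- b.
      by have := ab b; rewrite closed_adjxx /closed_adj eq_sym (negPf ne).
    split=> //; apply/eqP/setP => x; rewrite !inE; have := ab x; rewrite /closed_adj.
    rewrite [a == x]eq_sym [b == x]eq_sym.
    case: (eqVneq x a) => [->|_]; first by rewrite adj_irrefl andbF.
    by case: (eqVneq x b) => [->|_] //=; rewrite adj_irrefl.
  rewrite /closed_adj [a == x]eq_sym [b == x]eq_sym; have := eN x; rewrite !inE.
  case: (eqVneq x a) => [->|_] /=; first by rewrite (adj_sym b) ab orbT.
  by case: (eqVneq x b) => [->|_] //=; rewrite ab.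
by rewrite cardsU1 !inE adj_irrefl.
Qed.

Lemma twin_number_universal a : a \in universal_vertices X ->
  twin_number a = #|universal_vertices X|.
Proof.
by move=> Ua; rewrite twin_numberE; apply: eq_card => b; rewrite inE universal_twin.
Qed.

Lemma completeP : reflect (forall a b, closed_adj a b) (complete X).
Proof.
apply: (iffP forallP) => h a => [b|]; last apply/forallP => b.
  by have /forallP/(_ b) := h a; rewrite /closed_adj; case: eqP.
by have := h a b; rewrite /closed_adj; case: eqP.
Qed.

End ClosedTwins.

(** * Isomorphism invariance of the reconstruction *)

Section Isomorphisms.
Variables (X Y : sgraph) (f : X -> Y).
Hypotheses (bij_f : bijective f) (adj_f : forall a b : X, (f a -- f b) = (a -- b)).

Let inj_f : injective f := bij_inj bij_f.

Lemma iso_closed_adj a b : closed_adj (f a) (f b) = closed_adj a b.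
Proof. by rewrite /closed_adj adj_f (inj_eq inj_f). Qed.

Lemma iso_twin a b : twin (f a) (f b) = twin a b.
Proof.
have [g fK gK] := bij_f.
apply/twinP/twinP => h x; last by rewrite -(gK x) !iso_closed_adj.
by rewrite -!iso_closed_adj.
Qed.

Lemma iso_complete : complete X = complete Y.
Proof.
have [g fK gK] := bij_f.
apply/completeP/completeP => h a b; last by rewrite -iso_closed_adj.
by rewrite -(gK a) -(gK b) iso_closed_adj.
Qed.

Lemma iso_card_universal : #|universal_vertices X| = #|universal_vertices Y|.
Proof.
have [g fK gK] := bij_f; rewrite -(card_imset _ inj_f); apply: eq_card => y.
rewrite -(gK y) (mem_imset _ _ inj_f).
apply/universalP/universalP => h x; last by rewrite -iso_closed_adj.
by rewrite -(gK x) iso_closed_adj.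
Qed.

Lemma iso_twin_number a : twin_number (f a) = twin_number a.
Proof.
have [g fK gK] := bij_f; rewrite !twin_numberE -[RHS](card_imset _ inj_f).
by apply: eq_card => y; rewrite -(gK y) (mem_imset _ _ inj_f) !inE iso_twin.
Qed.

Lemma iso_recon_adj a b : recon_adj (f a) (f b) = recon_adj a b.
Proof.
have exE (P : pred Y) : [exists y, P y] = [exists x, P (f x)].
  have [g fK gK] := bij_f; apply/existsP/existsP => [[y Py]|[x Px]].
    by exists (g y); rewrite gK.
  by exists (f x).
rewrite /recon_adj (inj_eq inj_f) -iso_complete -iso_card_universal adj_f.
rewrite !iso_twin_number !exE.
congr (_ && _); case: complete => //; case: (2 < _) => //; case: (a -- b) => //.
by case: (_ == _); apply: eq_existsb => x; rewrite !adj_f iso_twin_number.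
Qed.

End Isomorphisms.

(** * Comparability and twins in power graphs *)

Section PowerGraph.
Variable gT : finGroupType.
Implicit Types (a b c d u x y z : gT) (H : {group gT}).
Local Notation PG := (power_graph gT).

Definition cadj : rel gT := @closed_adj PG.
Definition ptwin : rel gT := @twin PG.
Definition pnumber a : nat := @twin_number PG a.
Definition puniv : {set gT} := universal_vertices PG.

Lemma cadjE a b : cadj a b = (a \in <[b]>) || (b \in <[a]>).
Proof.
rewrite /cadj /closed_adj /= /power_adj -!cycle_subG.
by case: eqVneq => [->|]; rewrite ?subxx.
Qed.

Lemma cadj_sym a b : cadj a b = cadj b a.
Proof. exact: closed_adj_sym. Qed.

Lemma cadjxx a : cadj a a.
Proof. exact: closed_adjxx. Qed.

Lemma ptwinP a b : reflect (cadj a =1 cadj b) (ptwin a b).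
Proof. exact: (@twinP PG a b). Qed.

Lemma punivP a : reflect (forall x, cadj a x) (a \in puniv).
Proof. exact: (@universalP PG a). Qed.

Lemma puniv1 : 1 \in puniv.
Proof. by apply/punivP => x; rewrite cadjE group1. Qed.

Lemma eq_cycle_mem a b : a \in <[b]> -> b \in <[a]> -> <[a]> = <[b]>.
Proof. by rewrite -!cycle_subG => ab ba; apply/eqP; rewrite eqEsubset ab. Qed.

Lemma eq_cycle_ptwin a b : <[a]> = <[b]> -> ptwin a b.
Proof. by move=> ab; apply/ptwinP => x; rewrite !cadjE -!cycle_subG /= ab. Qed.

Lemma mem_cycle_dvd c a b : a \in <[c]> -> b \in <[c]> ->
  (a \in <[b]>) = (#[a] %| #[b]).
Proof.
by rewrite -!cycle_subG => ca cb; rewrite -(cardSg_cyclic (cycle_cyclic c)).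
Qed.

(** In a cyclic group, divisibility of orders decides inclusion of cyclic subgroups, and the powers
    of [p] form a chain. *)
Lemma cadj_p_elt (p : nat) z x y : p.-elt z -> x \in <[z]> -> y \in <[z]> -> cadj x y.
Proof.
move=> pz zx zy; rewrite cadjE (mem_cycle_dvd zx zy) (mem_cycle_dvd zy zx).
have [i ->] := p_natP (mem_p_elt pz zx); have [j ->] := p_natP (mem_p_elt pz zy).
apply/orP; case/orP: (leq_total i j) => ij; [left | right]; exact: dvdn_exp2l.
Qed.

Lemma p_elt_inj (p q : nat) c : c != 1 -> p.-elt c -> q.-elt c -> p = q.
Proof.
move=> c1 pc qc; apply/eqP; apply: contraR c1 => npq; rewrite -order_eq1.
apply/eqP/(@pnat_1 p) => //.
by apply: sub_in_pnat qc => r _ /eqnP->; rewrite !inE eq_sym.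
Qed.

(** An element of [H] outside [<[u]>] has a primary component outside [<[u]>]; this component must
    lie above [u], so [u] is a [p]-element. Any element of prime order [q] in [H] is comparable with
    [u != 1], which forces [q = p]. *)
Lemma comparable_subset_or_pgroup H u : u != 1 ->
    {in H, forall x, cadj u x} ->
  H \subset <[u]> \/ exists2 p : nat, prime p & p.-group H.
Proof.
move=> u1 cu; have [|/subsetPn[x Hx notux]] := boolP (H \subset <[u]>); first by left.
right; have /forallPn[[p /= _] xp] : ~~ [forall p : 'I_(#[x].+1), x.`_p \in <[u]>].
  apply: contra notux => /forallP h; rewrite -(prod_constt x) big_mkord.
  exact: group_prod.
have p_pr : prime p.
  apply: contraR xp => np; suff -> : x.`_p = 1 by exact: group1.
  by apply/eqP; rewrite -order_eq1 order_constt p_part lognE (negPf np).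
have pu : p.-elt u.
  have := cu x.`_p (groupX _ Hx); rewrite cadjE (negPf xp) orbF.
  exact: mem_p_elt (p_elt_constt _ _).
exists p => //; apply/pgroupP => q q_pr /(Cauchy q_pr)[y Hy oy].
have := cu y Hy; rewrite cadjE => /orP[uy|/(mem_p_elt pu)]; last first.
  by rewrite /p_elt oy pnatE.
suff -> : p = q by rewrite inE.
by apply: (p_elt_inj u1) => //; apply: mem_p_elt uy; rewrite /pgroup -/#[y] oy pnat_id.
Qed.

(** Twins are comparable, so let [d] lie in [<[c]>]. Like its twin [c], it is comparable with all of
    [<[c]>], and [<[c]>] is not inside [<[d]>], so [comparable_subset_or_pgroup] leaves only the
    [p]-group case. *)
Lemma ptwin_neq_p_elt c d : ptwin c d -> c != 1 -> d != 1 -> <[c]> != <[d]> ->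
  exists2 p : nat, prime p & p.-elt c /\ p.-elt d.
Proof.
wlog dc : c d / d \in <[c]> => [WL|] tw c1 d1 ne.
  have := ptwinP _ _ tw d; rewrite cadjxx cadjE => /orP[cd|dc]; last exact: WL.
  have [||p pr [pd pc]] := WL d c cd _ d1 c1; first by rewrite /ptwin twin_sym.
    by rewrite eq_sym.
  by exists p.
have [x cx||[p p_pr pc]] := @comparable_subset_or_pgroup <[c]> d d1.
- by rewrite -(ptwinP _ _ tw) cadjE cx orbT.
- by rewrite cycle_subG => cd; rewrite (eq_cycle_mem cd dc) eqxx in ne.
by exists p => //; split=> //; apply: mem_p_elt dc.
Qed.

Lemma not_puniv_neq1 a : a \notin puniv -> a != 1.
Proof. by apply: contraNneq => ->; apply: puniv1. Qed.

Lemma ptwin_puniv a d : ptwin a d -> (a \in puniv) = (d \in puniv).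
Proof. exact: twin_universal. Qed.

(* Suppose [u] and [v] are [p]-elements of [<[c]>] with [<[u]>] strictly below
   [<[v]>]. If [y] in [<[c]>] has prime order [q != p], then [u * y] is
   comparable with [u] but not with [v], so [u] and [v] are not twins. *)
Lemma ptwin_cycle_eq c a d : ~ (exists2 p : nat, prime p & p.-elt c) ->
  a \in <[c]> -> a \notin puniv -> ptwin a d -> <[a]> = <[d]>.
Proof.
move=> npc ca Ua tw; apply/eqP; apply: contraT => ne.
have a1 := not_puniv_neq1 Ua.
have d1 : d != 1 by apply: not_puniv_neq1; rewrite -(ptwin_puniv tw).
have [p p_pr [pa pd]] := ptwin_neq_p_elt tw a1 d1 ne.
have cd : d \in <[c]>.
  have : cadj d c by rewrite -(ptwinP _ _ tw) cadjE ca.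
  by rewrite cadjE => /orP[//|/(mem_p_elt pd) pc]; case: npc; exists p.
have [q q_pr [qc nqp]] : exists2 q, prime q & q %| #[c] /\ q != p.
  have : ~~ p.-nat #[c] by apply/negP => pc; case: npc; exists p.
  rewrite /pnat order_gt0 /= => /allPn[q]; rewrite mem_primes => /and3P[q_pr _ qc] nqp.
  by exists q.
have [y cy oy] := Cauchy q_pr qc.
have twin_mem u v : u \in <[c]> -> v \in <[c]> -> p.-elt u -> p.-elt v ->
    ptwin u v -> v \in <[u]>.
  move=> cu cv pu pv uv; have co_p (w : gT) : p.-elt w -> coprime #[w] #[y].
    by move=> pw; rewrite oy (pnat_coprime pw) // pnatE.
  have comm : commute u y.
    by apply: (centsP (cycle_abelian c)).
  have ox := orderM comm (co_p _ pu).
  have cx : u * y \in <[c]> by rewrite groupM.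
  have : cadj v (u * y).
    by rewrite -(ptwinP _ _ uv) cadjE (mem_cycle_dvd cu cx) ox dvdn_mulr.
  rewrite cadjE (mem_cycle_dvd cv cx) (mem_cycle_dvd cx cv) ox
    => /orP[|/(dvdn_trans (dvdn_mull _ (dvdnn _)))].
    by rewrite (mem_cycle_dvd cv cu) Gauss_dvdl ?co_p.
  rewrite oy => qv; have := pnat_dvd qv pv; rewrite pnatE // => /eqP qp.
  by rewrite qp eqxx in nqp.
have e1 := twin_mem _ _ ca cd pa pd tw.
rewrite /ptwin twin_sym in tw.
by have e2 := twin_mem _ _ cd ca pd pa tw; rewrite (eq_cycle_mem e2 e1) eqxx in ne.
Qed.

(** * Bounds on twin numbers *)

Lemma totient_leq_pnumber a : totient #[a] <= pnumber a.
Proof.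
rewrite totient_gen /pnumber twin_numberE; apply: subset_leq_card.
by apply/subsetP => b; rewrite !inE => /eqP; apply: eq_cycle_ptwin.
Qed.

Lemma pnumber_totient a :
  (forall d, ptwin a d -> <[a]> = <[d]>) -> pnumber a = totient #[a].
Proof.
move=> plain; rewrite totient_gen /pnumber twin_numberE.
apply: eq_card => d; rewrite !inE; apply/idP/eqP; first exact: plain.
exact: eq_cycle_ptwin.
Qed.

Lemma not_cadj_puniv a b : ~~ cadj a b -> a \notin puniv.
Proof. by apply: contra => /punivP. Qed.

(* Twins are pairwise comparable, so a twin class without 1 lies in the cyclic
   subgroup generated by any of its elements of maximal order. *)
Lemma pnumber_lt_max_order c : c \notin puniv ->
  exists2 y, ptwin c y & c \in <[y]> /\ pnumber c < #[y].
Proof.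
move=> Uc; have [y cy ymax] := @arg_maxnP _ c (ptwin c) order (twin_refl (c : PG)).
have mem_y d : ptwin c d -> d \in <[y]>.
  move=> cd; have yd : cadj y d.
    by rewrite -(ptwinP _ _ cy) (ptwinP _ _ cd) cadjxx.
  move: yd; rewrite cadjE => /orP[yd|//].
  suff -> : <[y]> = <[d]> by apply: cycle_id.
  apply/eqP; rewrite eqEcard cycle_subG yd; exact: ymax.
exists y => //; split; first exact/mem_y/(twin_refl (c : PG)).
rewrite /pnumber twin_numberE; apply: proper_card; apply/properP; split.
  by apply/subsetP => d; rewrite inE; apply: mem_y.
exists 1; first exact: group1.
rewrite inE; apply: contra Uc => /ptwin_puniv ->; exact: puniv1.
Qed.

Lemma pnumber_leq c a : c \in <[a]> -> c \notin puniv -> ~~ ptwin c a ->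
  pnumber c <= pnumber a.
Proof.
move=> ac Uc ntw.
have [plain|] := boolP [forall d, ptwin c d ==> (<[c]> == <[d]>)].
  rewrite pnumber_totient => [|d cd]; last exact/eqP/(implyP (forallP plain d)).
  apply: leq_trans (totient_leq_pnumber a).
  by apply: leq_totient_dvd; rewrite ?order_gt0 // order_dvdG.
case/forallPn => d; rewrite negb_imply => /andP[cd ne].
have d1 : d != 1 by apply: not_puniv_neq1; rewrite -(ptwin_puniv cd).
have [p p_pr [pc _]] := ptwin_neq_p_elt cd (not_puniv_neq1 Uc) d1 ne.
have [y cy [yc lt_y]] := pnumber_lt_max_order Uc.
have ya : cadj y a by rewrite -(ptwinP _ _ cy) cadjE ac.
have c1 := not_puniv_neq1 Uc.
(* If [a] were not a [p]-element, [ptwin_cycle_eq] inside [<[a]>] would give [<[c]> = <[d]>]. *)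
have [pa|npa] := boolP (p.-elt a); last first.
  case/eqP: ne; apply: (ptwin_cycle_eq _ ac) => // -[q q_pr qa].
  have qc := mem_p_elt qa ac; case/negP: npa.
  by rewrite (p_elt_inj c1 pc qc).
have py : p.-elt y.
  have [cy_eq|ne_y] := eqVneq <[c]> <[y]>.
    by apply: mem_p_elt pc _; rewrite /= cy_eq cycle_id.
  have [|q _ [qc qy]] := ptwin_neq_p_elt cy c1 _ ne_y.
    by apply: not_puniv_neq1; rewrite -(ptwin_puniv cy).
  by rewrite (p_elt_inj c1 pc qc).
(* Otherwise [a] would lie between the twins [c] and [y] in a cyclic [p]-group and so be a twin of
   both. *)
have notya : a \notin <[y]>.
  apply: contra ntw => aly; apply/ptwinP => x; apply/idP/idP.
    move=> cx; have yx : cadj y x by rewrite -(ptwinP _ _ cy).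
    move: yx; rewrite cadjE => /orP[yx|xy]; last exact: cadj_p_elt py aly xy.
    by rewrite cadjE; apply/orP; left; apply: subsetP aly; rewrite cycle_subG.
  rewrite cadjE => /orP[ax|xa].
    by rewrite cadjE; apply/orP; left; apply: subsetP ac; rewrite cycle_subG.
  by rewrite (ptwinP _ _ cy); apply: cadj_p_elt py (cycle_id y) _;
    apply: subsetP xa; rewrite cycle_subG.
move: ya; rewrite cadjE (negPf notya) orbF => ya.
apply: leq_trans (ltnW lt_y) (leq_trans _ (totient_leq_pnumber a)).
have lt_ya : #[y] < #[a].
  apply: proper_card; rewrite properEneq cycle_subG ya andbT.
  by apply: contraNneq notya => ->; apply: cycle_id.
have [i oa] := p_natP pa; have [j oy] := p_natP py.
(* As [j < i], the totient [(p - 1) * p ^ (i - 1)] of [#[a]] is at least [p ^ (i - 1) >= p ^ j]. *)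
move: lt_ya; rewrite oa oy ltn_exp2l ?prime_gt1 // => lt_ji.
rewrite totient_pfactor // ?(leq_ltn_trans _ lt_ji) //.
apply: (@leq_trans (p ^ i.-1)).
  by rewrite leq_exp2l ?prime_gt1 //; case: (i) lt_ji.
by rewrite leq_pmull //; case: (p) (prime_gt1 p_pr) => [|[]].
Qed.

(** * Universal vertices of the power graph *)

Lemma cadj_commute a b : cadj a b -> commute a b.
Proof.
rewrite cadjE => /orP[ab|ba].
  by apply: (centsP (cycle_abelian b)); rewrite ?cycle_id.
by apply: (centsP (cycle_abelian a)); rewrite ?cycle_id.
Qed.

Lemma universal_gt2_cyclic : 2 < #|puniv| -> cyclic [set: gT].
Proof.
move=> U2; have [u Uu umax] := arg_maxnP order puniv1.
(* By maximality of its order, [u] generates a subgroup containing every universal vertex. *)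
have u2 : 2 < #[u].
  apply: leq_trans U2 (subset_leq_card _); apply/subsetP => v Uv.
  have : cadj u v by apply/punivP.
  rewrite cadjE => /orP[uv|//]; suff -> : <[u]> = <[v]> by apply: cycle_id.
  by apply/eqP; rewrite eqEcard cycle_subG uv; apply: umax.
have u1 : u != 1 by apply: contraTneq u2 => ->; rewrite order1.
have [x _||[p p_pr pG]] := @comparable_subset_or_pgroup [set: gT] u u1.
- exact/punivP.
- by move/cyclicS; apply; apply: cycle_cyclic.
have ntG : [set: gT] != 1.
  apply: contra_neq u1 => eqG.
  by have := in_setT u; rewrite eqG => /set1P.
have pu : p.-elt u by apply: mem_p_elt pG (in_setT u).
(* An element of order dividing [p] is comparable with [u], whose order is a positive power of [p],
   so it lies in [<[u]>]. *)
have sOu : 'Ohm_1([set: gT]) \subset <[u]>.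
  rewrite (OhmE 1 pG) gen_subG; apply/subsetP => x /LdivP[_ /eqP].
  rewrite -order_dvdn expn1 => xp.
  have : cadj u x by apply/punivP.
  rewrite cadjE => /orP[ux|//] /=; suff -> : <[u]> = <[x]> by apply: cycle_id.
  apply/eqP; rewrite eqEcard cycle_subG ux -!/#[_]; apply: dvdn_leq => //.
  apply: dvdn_trans xp _; have [[|i] oi] := p_natP pu; last by rewrite oi expnS dvdn_mulr.
  by rewrite oi in u2.
have oO : #|'Ohm_1([set: gT])| = p.
  rewrite -(Ohm1_cyclic_pgroup_prime (cycle_cyclic u) pu) ?cycle_eq1 //.
  congr #|pred_of_set _|; apply/eqP; rewrite eqEsubset -{1}(Ohm_id 1 [set: gT]).
  by apply/andP; split; apply: OhmS; rewrite ?subsetT.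
have /orP[//|/andP[_ /eqP/quaternion_classP[n n2 isoG]]] :=
  introT (prime_Ohm1P pG ntG) oO.
have [[x y] genG _] := generators_quaternion n2 isoG.
have [_ _ [_ oZ _ _ _] _ _] := quaternion_structure n2 genG isoG.
(* The centre of a generalized quaternion group has order 2, too small for the central element
   [u]. *)
have : <[u]> \subset 'Z([set: gT]).
  rewrite cycle_subG; apply/centerP; split=> // z _.
  by apply: cadj_commute; apply/punivP.
by move/subset_leq_card; rewrite oZ -/#[u] leqNgt u2.
Qed.

Lemma pnumber_gt1 a : #|puniv| = 2 -> a \notin puniv -> 1 < pnumber a.
Proof.
move=> U2 Ua; apply: leq_trans (totient_leq_pnumber a).
rewrite totient_gt1 ltnNge; apply: contra Ua => oa2.
have := U2; rewrite (cardsD1 1) puniv1 add1n => -[U1].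
have /card_gt0P[z] : 0 < #|puniv :\ 1| by rewrite U1.
rewrite in_setD1 => /andP[z1 Uz].
(* Generators of [<[z]>] are twins of [z], hence universal and nontrivial; there is only one such
   vertex, so [totient #[z] <= 1]. *)
have oz2 : #[z] <= 2.
  rewrite leqNgt -totient_gt1 -leqNgt -U1 totient_gen; apply: subset_leq_card.
  apply/subsetP => x; rewrite inE in_setD1 => /eqP zx.
  rewrite -(ptwin_puniv (eq_cycle_ptwin zx)) Uz andbT.
  by rewrite -cycle_eq1 -zx cycle_eq1 z1.
have [-> | a1] := eqVneq a 1; first exact: puniv1.
have gt1 x : x != 1 -> 1 < #[x] by rewrite order_gt1.
have za : cadj z a by apply/punivP.
suff /eq_cycle_ptwin/ptwin_puniv <- : <[z]> = <[a]> by [].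
apply/eqP; move: za; rewrite cadjE => /orP[za|az].
  by rewrite eqEcard cycle_subG za -!/#[_] (leq_trans oa2) ?gt1.
by rewrite eq_sym eqEcard cycle_subG az -!/#[_] (leq_trans oz2) ?gt1.
Qed.

(** * Common neighbours of non-adjacent vertices *)

Lemma recon_forward a b c : a \in <[c]> -> b \in <[c]> -> ~~ cadj a b ->
  [&& @adj PG a c, @adj PG b c &
   if pnumber a == pnumber b then pnumber a < pnumber c
   else maxn (pnumber a) (pnumber b) <= pnumber c].
Proof.
move=> ca cb nab.
have npc : ~ (exists2 p : nat, prime p & p.-elt c).
  by case=> p _ pc; rewrite (cadj_p_elt pc ca cb) in nab.
have Ua := not_cadj_puniv nab; have Ub : b \notin puniv.
  by apply: (@not_cadj_puniv b a); rewrite cadj_sym.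
have neigh x y : x \in <[c]> -> y \in <[c]> -> ~~ cadj x y ->
    @adj PG x c /\ #[x] != #[c].
  move=> cx cy nxy; have nexc : #[x] != #[c].
    apply: contra nxy => /eqP oxc; rewrite cadjE.
    suff -> : <[x]> = <[c]> by rewrite cy orbT.
    by apply/eqP; rewrite eqEcard cycle_subG cx -/#[c] -oxc leqnn.
  split=> //; rewrite /= /power_adj cycle_subG cx andbT.
  by apply: contra_neq nexc => ->.
have [-> oa] := neigh a b ca cb nab.
have [|-> ob] := neigh b a cb ca; first by rewrite cadj_sym.
have plain x : x \in <[c]> -> x \notin puniv -> pnumber x = totient #[x].
  by move=> cx Ux; apply: pnumber_totient => d; apply: ptwin_cycle_eq npc cx Ux.
have le x : x \in <[c]> -> totient #[x] <= totient #[c].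
  by move=> cx; apply: leq_totient_dvd; rewrite ?order_gt0 ?order_dvdG.
rewrite (plain a) // (plain b) //=; case: ifP => [/eqP ab|_]; last first.
  by apply: leq_trans (totient_leq_pnumber c); rewrite geq_max !le.
apply: leq_trans (totient_leq_pnumber c); rewrite ltn_neqAle le // andbT.
(* Equality would give [#[c]] as the double of both [#[a]] and [#[b]]; elements of equal order in
   [<[c]>] are comparable. *)
apply: contra nab => /eqP ac; have c0 := order_gt0 c.
have dac := totient_dvd_eq c0 (order_dvdG ca) oa ac.
have dbc := totient_dvd_eq c0 (order_dvdG cb) ob (etrans (esym ab) ac).
by rewrite cadjE (mem_cycle_dvd ca cb) (double_inj (etrans (esym dac) dbc)) dvdnn.
Qed.

(** If [c] is above both [a] and [b], it is the witness; above one and below the other, it would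
    make them comparable; below both, its twin number is too small for the condition. *)
Lemma recon_backward a b c : 2 >= #|puniv| -> @adj PG a c -> @adj PG b c ->
  (if pnumber a == pnumber b then pnumber a < pnumber c
   else maxn (pnumber a) (pnumber b) <= pnumber c) ->
  ~~ cadj a b -> exists d, (a \in <[d]>) && (b \in <[d]>).
Proof.
move=> U2 adj_ac adj_bc cond nab.
have ca : cadj a c by rewrite /cadj /closed_adj adj_ac orbT.
have cb : cadj b c by rewrite /cadj /closed_adj adj_bc orbT.
have below x y : cadj x y -> x \notin <[y]> -> y \in <[x]>.
  by rewrite cadjE => /orP[->|].
have [ac|nac] := boolP (a \in <[c]>).
  have [bc|nbc] := boolP (b \in <[c]>); first by exists c; rewrite ac.
  case/negP: nab; rewrite cadjE; apply/orP; left.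
  by apply: subsetP ac; rewrite cycle_subG below.
have {nac} ac := below _ _ ca nac.
have [bc|nbc] := boolP (b \in <[c]>).
  case/negP: nab; rewrite cadjE; apply/orP; right.
  by apply: subsetP bc; rewrite cycle_subG.
have {nbc} bc := below _ _ cb nbc.
have nba : ~~ cadj b a by rewrite cadj_sym.
(* A twin [x] of [c] would inherit the neighbour [y] of [c]. *)
have le x y : c \in <[x]> -> cadj x c -> cadj y c -> ~~ cadj x y -> c \notin puniv ->
    pnumber c <= pnumber x.
  move=> xc cx cy nxy Uc; apply: pnumber_leq => //.
  by apply: contra nxy => tw; rewrite -(ptwinP _ _ tw) cadj_sym.
exfalso; move: cond; have [Uc|Uc] := boolP (c \in puniv); last first.
  have lea := le a b ac ca cb nab Uc; have leb := le b a bc cb ca nba Uc.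
  case: ifP => [/eqP eq_ab|/eqP ne]; first by rewrite ltnNge lea.
  rewrite geq_max => /andP[la lb]; case: ne.
  by apply/eqP; rewrite eqn_leq (leq_trans la leb) (leq_trans lb lea).
have Nc : pnumber c = #|puniv| by apply: (@twin_number_universal PG).
have Ua := not_cadj_puniv nab; have Ub := not_cadj_puniv nba.
have Na0 : 0 < pnumber a by []; have Nb0 : 0 < pnumber b by [].
(* With at most one universal vertex, the strict condition fails since twin numbers are positive,
   and the other one would make both twin numbers 1, hence equal. *)
rewrite Nc => cond; have Ueq2 : #|puniv| = 2.
  apply/eqP; rewrite eqn_leq U2 /= ltnNge; apply/negP => U1; move: cond.
  case: ifP => [_ /leq_trans/(_ U1)|/eqP ne]; first by rewrite ltnNge Na0.
  rewrite geq_max => /andP[/leq_trans/(_ U1) a1 /leq_trans/(_ U1) b1]; case: ne.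
  by apply/eqP; rewrite eqn_leq (leq_trans a1 Nb0) (leq_trans b1 Na0).
have a2 := pnumber_gt1 Ueq2 Ua; have b2 := pnumber_gt1 Ueq2 Ub.
move: cond; rewrite Ueq2; case: ifP => [_|/eqP ne]; first by rewrite ltnNge a2.
rewrite geq_max => /andP[la lb]; case: ne.
by apply/eqP; rewrite eqn_leq (leq_trans la b2) (leq_trans lb a2).
Qed.

Lemma recon_power_graph a b : @recon_adj PG a b = epower_adj a b.
Proof.
rewrite /recon_adj /epower_adj; case: eqVneq => //= ne.
have cadj_epower : cadj a b -> [exists c : gT, (a \in <[c]>) && (b \in <[c]>)].
  rewrite cadjE => /orP[ab|ba]; apply/existsP.
    by exists b; rewrite ab cycle_id.
  by exists a; rewrite ba cycle_id.
case: ifP => [/completeP h|_]; first by rewrite cadj_epower // /cadj h.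
(* A generator of the whole group witnesses every edge. *)
case: ltnP => [/universal_gt2_cyclic/cyclicP[c eqG]|U2].
  by symmetry; apply/existsP; exists c; rewrite -eqG !inE.
case: ifP => [ab|nab]; first by rewrite cadj_epower // /cadj /closed_adj /= ab orbT.
have ncab : ~~ cadj a b by rewrite /cadj /closed_adj (negPf ne) /= nab.
rewrite -/(pnumber a) -/(pnumber b).
apply/idP/existsP => [h | [c /andP[ca cb]]]; last first.
  have /and3P[ac bc cond] := recon_forward ca cb ncab.
  by move: cond; case: ifP => _ cond; apply/existsP; exists c; apply/and3P.
have [c /and3P[ac bc cond]] : exists c, [&& @adj PG a c, @adj PG b c &
    if pnumber a == pnumber b then pnumber a < pnumber c
    else maxn (pnumber a) (pnumber b) <= pnumber c].
  by move: h; case: ifP => _ /existsP[c h]; exists c.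
exact: recon_backward U2 ac bc cond ncab.
Qed.

End PowerGraph.

Theorem mainTheorem3 (X : sgraph) (gT : finGroupType) :
  graph_iso X (power_graph gT) ->
  graph_iso (reconstruction X) (enhanced_power_graph gT).
Proof.
(* The same bijection works: the reconstruction is invariant under isomorphism, and for the power
   graph it is the enhanced power graph on the same vertices. *)
case=> f bij_f adj_f; exists f => // a b.
by rewrite /= -(iso_recon_adj bij_f adj_f) recon_power_graph.
Qed.
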